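(* Let $\lambda\ge1$ be an integer. Consider a randomized one-pass streaming algorithm that is given as input an integer $\kappa$, followed by a stream of the edges of an $n$-vertex graph $G$ with degeneracy $\kappa(G)=\kappa$, and that (with probability at least $2/3$) produces a proper $(\kappa+\lambda)$-coloring of $G$. Such an algorithm requires $\Omega(n^2/\lambda^2)$ bits of space. Furthermore, if we require $\lambda=O(\kappa^{1/2-\gamma})$ for some constant $\gamma>0$, then the task does not admit a semi-streaming algorithm (one using $\widetilde{O}(n)$ bits of space).
   Context: The degeneracy $\kappa(G)$ is the least $k$ such that every induced subgraph of $G$ has a vertex of degree at most $k$. The stream is a listing of the edges of $G$ in arbitrary order (insertion-only). $\widetilde{O}$ hides polylogarithmic factors in $n$. *)

(* Defs.v *)
From HB Require Import structures.
From mathcomp Require Import all_boot all_order all_algebra.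
From mathcomp Require Import all_classical all_reals all_analysis.

Set Implicit Arguments.
Unset Strict Implicit.
Unset Printing Implicit Defensive.

Import Order.TTheory GRing.Theory Num.Theory.

Record graph (n : nat) := Graph {
  adj : rel 'I_n;
  adj_sym : symmetric adj;
  adj_irr : irreflexive adj
}.

Section Graphs.
Variable n : nat.
Implicit Types (G : graph n) (S : {set 'I_n}).

Definition edges G : {set {set 'I_n}} :=
  [set [set p.1; p.2] | p : 'I_n * 'I_n & adj G p.1 p.2].

Definition induced_degree G S (v : 'I_n) : nat := #|[set u in S | adj G v u]|.

Definition degenerate G (k : nat) : bool :=
  [forall S : {set 'I_n},
     (S != finset.set0) ==> [exists v in S, induced_degree G S v <= k]].

Lemma degenerate_exists G : exists k, degenerate G k.
Proof.
exists n; apply/forallP => S; apply/implyP => /set0Pn[v vS].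
apply/existsP; exists v; rewrite vS /=.
by rewrite -[leqRHS](card_ord n); exact: max_card.
Qed.

Definition degeneracy G : nat := ex_minn (degenerate_exists G).

Definition edge_stream G (st : seq {set 'I_n}) : bool :=
  perm_eq st (enum (edges G)).

Definition proper_coloring G (q : nat) (c : {ffun 'I_n -> nat}) : Prop :=
  (forall v, c v < q) /\ (forall u v, adj G u v -> c u != c v).

End Graphs.

(* One-pass algorithm on n-vertex graphs whose memory is a string of s bits.
   The first argument of [update] is the number of edges already read; together
   with the coins of [rand_algorithm] it lets an algorithm draw fresh coins at
   every step.  Neither this clock nor the coins are charged as space. *)
Record det_algorithm (n s : nat) := DetAlgorithm {
  init : nat -> s.-tuple bool;
  update : nat -> s.-tuple bool -> {set 'I_n} -> s.-tuple bool;
  output : s.-tuple bool -> {ffun 'I_n -> nat}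
}.

Fixpoint process (n s : nat) (A : det_algorithm n s) (t : nat)
    (m : s.-tuple bool) (st : seq {set 'I_n}) : s.-tuple bool :=
  if st is e :: st' then process A t.+1 (update A t m e) st' else m.

Definition run (n s : nat) (A : det_algorithm n s) (kappa : nat)
    (st : seq {set 'I_n}) : {ffun 'I_n -> nat} :=
  output A (process A 0 (init A kappa) st).

Record rand_algorithm (R : realType) (n s : nat) := RandAlgorithm {
  coin_display : measure_display;
  coins : measurableType coin_display;
  coin_law : probability coins R;
  alg_of : coins -> det_algorithm n s;
  run_measurable : forall kappa st c,
    measurable [set w | run (alg_of w) kappa st = c]%classic
}.
Arguments alg_of {R n s} r w.

(* The number of extra colors may depend on the input kappa. *)
Definition colors_with (R : realType) (n s : nat) (A : rand_algorithm R n s)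
    (lambda : nat -> nat) : Prop :=
  forall (G : graph n) (st : seq {set 'I_n}), edge_stream G st ->
  let kappa := degeneracy G in
  ((2 / 3 : R)%R%:E <=
   coin_law A [set w | proper_coloring G (kappa + lambda kappa)
                         (run (alg_of A w) kappa st)]%classic)%E.

Definition soft_linear (R : realType) (s : nat -> nat) : Prop :=
  exists (C : R) (k n0 : nat), forall n, n0 <= n ->
    ((s n)%:R <= C * n%:R * ln n%:R ^+ k)%R.

Definition admits_semi_streaming (R : realType) (lambda : nat -> nat -> nat) :
    Prop :=
  exists (s : nat -> nat) (A : forall n, rand_algorithm R n (s n)),
    soft_linear R s /\ forall n, colors_with (A n) (lambda n).

(* Main.v *)
Require Import Defs.
From HB Require Import structures.
From mathcomp Require Import all_boot all_order all_algebra.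
From mathcomp Require Import all_classical all_reals all_analysis.
From mathcomp Require Import measurable_realfun.
From mathcomp Require Import zify ring lra.

(** A coloring algorithm solves the INDEX problem.  Alice encodes an m x m bit
    matrix x by blocks A_i, B_j^0, B_j^1 of t >= lambda vertices each, joining A_i
    completely to B_j^b for b = x(i,j).  To read x(i,j), Bob adds a hub clique of
    k vertices joined to A_i, B_j^0 and B_j^1, makes A_i a clique and
    B_j^0 u B_j^1 a clique.  Whatever x is, the degeneracy is k + 2t - 1, so Alice
    knows kappa in advance.  A coloring with at most k + 3t - 1 colors forces A_i
    to share a color with the block B_j^b it is not joined to, which reveals the
    bit.  Alice's number of edges does not depend on x either, so the free clock
    tells Bob nothing.

    INDEX on N = m^2 bits needs about N/15 bits of memory: fixing good coins, if x
    and the string decoded from its message agree on a(x) bits, with average at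
    least 2N/3, then convexity bounds the sum of 2^a(x) below by about
    2^N 2^(2N/3), while every one of the 2^s messages contributes at most 3^N.
    Taking m of order n/t gives the space bound n^2/lambda^2, and t of order
    n^(1/2-gamma) gives n^(1+2 gamma), beyond any n polylog(n). *)

Set Implicit Arguments.
Unset Strict Implicit.
Unset Printing Implicit Defensive.

Import Order.TTheory GRing.Theory Num.Theory.

(** * Message length for INDEX *)

Definition agreement (I : finType) (x y : {ffun I -> bool}) : nat :=
  #|[set i | x i == y i]|.

(** The sum factors over coordinates: weight 2 for the value of [y], weight 1 for the other. *)
Lemma sum_exp2_agreement (I : finType) (y : {ffun I -> bool}) :
  \sum_(x : {ffun I -> bool}) 2 ^ agreement x y = 3 ^ #|I|.
Proof.
transitivity (\sum_(x : {ffun I -> bool})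
    \prod_(i : I) (if x i == y i then 2 else 1)).
  apply: eq_bigr => x _; rewrite -big_mkcond /= prod_nat_const.
  by congr (_ ^ _); apply: eq_card => i; rewrite !inE.
rewrite -(bigA_distr_bigA (fun i b => if b == y i then 2 else 1)).
under eq_bigr => i _.
  rewrite (_ : \sum_j _ = 3); last by rewrite big_bool; case: (y i).
  over.
by rewrite prod_nat_const.
Qed.

(* The integer form of convexity of [2 ^ a], at the point [L]: the line through
   [(L - 1, 0)] and [(L, 2 ^ L)] lies below the curve at every integer. *)
Lemma exp2_secant (L a : nat) : 2 ^ L * a.+1 <= 2 ^ a + L * 2 ^ L.
Proof.
have [le_La | /ltnW lt_aL] := leqP L a.
  rewrite -(subnKC le_La); move: (a - L) => d.
  rewrite expnD -addnS mulnDr [L * _]mulnC addnC leq_add2r.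
  by rewrite leq_mul2l ltn_expl ?orbT.
have [-> | ltaL] := eqVneq a L; first by rewrite mulnS mulnC.
apply: leq_trans (leq_addl _ _); rewrite mulnC leq_mul2r.
by rewrite ltn_neqAle ltaL lt_aL orbT.
Qed.

(** The sum of [2 ^ agreement] is bounded above message by message, and below by summing the secant
    at [L], which the average agreement reaches. *)
Lemma index_message_card (I M : finType)
    (f : {ffun I -> bool} -> M) (g : M -> {ffun I -> bool}) (L : nat) :
  L * 2 ^ #|I| <= \sum_x agreement x (g (f x)) ->
  2 ^ (L + #|I|) <= #|M| * 3 ^ #|I|.
Proof.
move=> Lagree.
have cardX : #|{ffun I -> bool}| = 2 ^ #|I| by rewrite card_ffun card_bool.
have upper : \sum_x 2 ^ agreement x (g (f x)) <= #|M| * 3 ^ #|I|.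
  rewrite -sum_nat_const.
  under [leqRHS]eq_bigr => v _ do rewrite -(sum_exp2_agreement (g v)).
  rewrite exchange_big /=; apply: leq_sum => x _.
  by rewrite (bigD1 (f x)) //= leq_addr.
apply: leq_trans upper.
have : \sum_(x : {ffun I -> bool}) 2 ^ L * (agreement x (g (f x))).+1 <=
       \sum_(x : {ffun I -> bool}) (2 ^ agreement x (g (f x)) + L * 2 ^ L).
  by apply: leq_sum => x _; apply: exp2_secant.
rewrite big_split /= sum_nat_const cardX -big_distrr /=.
(* The extra 1 in the secant survives as [2 ^ (L + #|I|)]; the terms in [L] are absorbed by
   [Lagree]. *)
under eq_bigr => x _ do rewrite -addn1.
rewrite big_split /= sum_nat_const cardX muln1 expnD.
rewrite mulnDr => secant.
rewrite -(leq_add2r (2 ^ #|I| * (L * 2 ^ L))); apply: leq_trans secant.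
rewrite addnC leq_add2r mulnCA mulnA mulnC.
by rewrite leq_mul2l Lagree orbT.
Qed.

Lemma index_lower_bound (I : finType) (s : nat)
    (f : {ffun I -> bool} -> s.-tuple bool)
    (g : s.-tuple bool -> {ffun I -> bool}) :
  2 * (#|I| * 2 ^ #|I|) <= 3 * \sum_x agreement x (g (f x)) ->
  #|I| <= 15 * s + 10.
Proof.
set N := #|I| => agree.
pose L := (2 * N) %/ 3.
have LN : L * 3 <= 2 * N by apply: leq_trunc_div.
have : 2 ^ (L + N) <= 2 ^ s * 3 ^ N.
  have <- : #|{: s.-tuple bool}| = 2 ^ s by rewrite card_tuple card_bool.
  apply: (@index_message_card I _ f g L).
  rewrite -(@leq_pmul2l 3) //; apply: leq_trans agree.
  by rewrite !mulnA leq_mul2r (mulnC 3) LN orbT.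
(* Fifth powers, since 3^5 = 243 <= 256 = 2^8 bounds log2 3 by 8/5, below the 5/3 supplied by
   [L + N]. The floor in [L] costs the final 10. *)
rewrite -(leq_exp2r _ _ (isT : 0 < 5)) expnMn -!expnM => le5.
have le243 : 3 ^ (N * 5) <= 2 ^ (N * 8).
  have [-> // | N_gt0] := posnP N.
  by rewrite !(mulnC N) (expnM 3) (expnM 2) leq_exp2r.
have : 2 ^ ((L + N) * 5) <= 2 ^ (s * 5 + N * 8).
  by apply: leq_trans le5 _; rewrite expnD leq_mul2l le243 orbT.
rewrite leq_exp2l // => final.
have : 2 * N < L.+1 * 3 by rewrite -ltn_divLR.
lia.
Qed.

(** * Fixing good coins *)

(** The expected number of events that occur is at least [2 / 3 * #|J|], so some point reaches
    it. *)
Lemma exists_many_events (R : realType) (d : measure_display)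
    (T : measurableType d) (P : probability T R) (J : finType)
    (E : J -> set T) :
  (forall j, measurable (E j)) ->
  (forall j, (2 / 3 : R)%R%:E <= P (E j))%E ->
  exists w, 2 * #|J| <= 3 * #|[set j | w \in E j]|.
Proof.
move=> mE PE; apply: contrapT => noW.
have few w : 3 * #|[set j | w \in E j]|%SET < 2 * #|J|.
  by rewrite ltnNge; apply/negP => ?; apply: noW; exists w.
have sumE w : (\sum_(j <- enum J) (\1_(E j) w)%:E =
               (#|[set j | w \in E j]|%SET%:R : R)%:E)%E.
  rewrite sumEFin; congr EFin; rewrite big_enum /=.
  under eq_bigr => j _ do rewrite indicE.
  rewrite -natr_sum -sum1dep_card; congr (_%:R)%R; rewrite [RHS]big_mkcond /=.
  by apply: eq_bigr => j _; case: (w \in E j).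
have intE : (\int[P]_w \sum_(j <- enum J) (\1_(E j) w)%:E =
             \sum_(j <- enum J) P (E j))%E.
  rewrite ge0_integral_sum //.
  - by apply: eq_bigr => j _; rewrite integral_indic // setIT.
  - by move=> j; apply/measurable_EFinP; exact: measurable_indic.
have lower : ((2 / 3 * #|J|%:R : R)%:E <= \sum_(j <- enum J) P (E j))%E.
  have -> : (2 / 3 * #|J|%:R : R)%:E = (\sum_(j <- enum J) (2 / 3 : R)%:E)%E.
    by rewrite sumEFin big_enum /= sumr_const mulr_natr.
  by apply: lee_sum.
(* Counts are integers, so the strict bound [few] leaves a uniform gap of 1/3, which survives
   integration. *)
have upper : (\int[P]_w \sum_(j <- enum J) (\1_(E j) w)%:E <=
              (((2 * #|J|)%:R - 1) / 3 : R)%:E)%E.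
  rewrite -[leRHS]mule1 -(@probability_setT _ _ _ P) -integral_cst //.
  apply: ge0_le_integral => //.
  - by move=> w _; rewrite sume_ge0 // => j _; rewrite lee_fin.
  - apply: emeasurable_sum => j.
    by apply/measurable_EFinP; exact: measurable_indic.
  - move=> w _ /=; rewrite sumE lee_fin ler_pdivlMr // lerBrDr.
    by rewrite -natrM natr1 ler_nat mulnC; exact: few.
move: upper; rewrite intE => /(le_trans lower); rewrite lee_fin natrM.
lra.
Qed.

(** Colorings form a countable type, so the event is a countable union of sets that are empty or
    covered by [run_measurable]. *)
Lemma measurable_coloring_event (R : realType) (n s : nat)
    (A : rand_algorithm R n s) (kappa : nat) (st : seq {set 'I_n})
    (Q : {ffun 'I_n -> nat} -> Prop) :
  measurable [set w | Q (run (alg_of A w) kappa st)]%classic.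
Proof.
have -> : [set w | Q (run (alg_of A w) kappa st)]%classic =
    (\bigcup_c [set w | Q c /\ run (alg_of A w) kappa st = c])%classic.
  apply/seteqP; split => w /=; first by move=> Qw; exists (run (alg_of A w) kappa st).
  by case=> c _ [Qc ->].
apply: countable_bigcupT_measurable => [|c]; first exact: countableP.
case: (pselect (Q c)) => Qc.
  rewrite (_ : [set w | _]%classic =
    [set w | run (alg_of A w) kappa st = c]%classic); first exact: run_measurable.
  by apply/seteqP; split => w /= => [[]|].
rewrite (_ : [set w | _]%classic = classical_sets.set0) //.
by apply/seteqP; split => w /= => [[]|].
Qed.

(** * Degeneracy and embedded graphs *)

Lemma set2_eq (T : finType) (a b c d : T) : [set a; b] = [set c; d] ->
  (a = c /\ b = d) \/ (a = d /\ b = c).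
Proof.
move=> E.
have /set2P aE : a \in [set c; d] by rewrite -E set21.
have /set2P bE : b \in [set c; d] by rewrite -E set22.
have /set2P cE : c \in [set a; b] by rewrite E set21.
have /set2P dE : d \in [set a; b] by rewrite E set22.
by case: aE => aE; case: bE => bE; case: cE => cE; case: dE => dE; subst; auto.
Qed.

Lemma degeneracyE (n : nat) (G : graph n) (d : nat) :
  degenerate G d -> (forall e, degenerate G e -> d <= e) -> degeneracy G = d.
Proof.
rewrite /degeneracy => degG min_d; case: ex_minnP => e degGe min_e.
by apply/eqP; rewrite eqn_leq min_e ?min_d.
Qed.

Lemma degenerate_clique (n : nat) (G : graph n) (T : finType) (f : T -> 'I_n)
    (d : nat) :
  injective f -> (forall a b, a != b -> adj G (f a) (f b)) ->
  degenerate G d -> #|T| <= d.+1.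
Proof.
move=> f_inj f_clique /forallP/(_ [set f a | a : T])/implyP deg_f.
have [-> // | /card_gt0P[a0 _]] := posnP #|T|.
have /deg_f/existsP[v /andP[/imsetP[a _ ->]]] : [set f a | a : T] != finset.set0.
  by apply/set0Pn; exists (f a0); rewrite imset_f.
rewrite (cardD1 a) add1n ltnS; apply: leq_trans.
rewrite -(card_imset _ f_inj) subset_leq_card //.
apply/fintype.subsetP => _ /imsetP[b + ->]; rewrite !inE => /andP[ba _].
by rewrite imset_f //= f_clique // eq_sym.
Qed.

Section ImageGraph.
Variables (n : nat) (W : finType) (iota : W -> 'I_n).
Hypothesis iota_inj : injective iota.
Implicit Types (r : rel W).

(** Vertices outside the range of [iota] are isolated, so the gadget need not fill all [n]
    vertices. *)
Definition image_rel r : rel 'I_n := fun u v =>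
  [exists p : W * W, [&& u == iota p.1, v == iota p.2 & r p.1 p.2]].

Lemma image_relP r u v :
  reflect (exists a b, [/\ u = iota a, v = iota b & r a b]) (image_rel r u v).
Proof.
apply: (iffP existsP) => [[[a b] /and3P[/eqP-> /eqP-> rab]] | [a [b [-> -> rab]]]].
  by exists a, b.
by exists (a, b); rewrite !eqxx.
Qed.

Lemma image_relE r a b : image_rel r (iota a) (iota b) = r a b.
Proof.
by apply/image_relP/idP => [[a' [b' [/iota_inj-> /iota_inj-> //]]] | rab]; exists a, b.
Qed.

Lemma image_rel_sym r : symmetric r -> symmetric (image_rel r).
Proof.
move=> r_sym u v; apply/image_relP/image_relP => -[a [b [-> -> rab]]];
by exists b, a; rewrite r_sym.
Qed.

Lemma image_rel_irr r : irreflexive r -> irreflexive (image_rel r).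
Proof.
move=> r_irr u; apply/image_relP => -[a [b [-> /iota_inj<-]]].
by rewrite r_irr.
Qed.

Definition image_graph r (r_sym : symmetric r) (r_irr : irreflexive r) :
  graph n := Graph (image_rel_sym r_sym) (image_rel_irr r_irr).

Lemma image_edgesP r (r_sym : symmetric r) (r_irr : irreflexive r) e :
  reflect (exists a b, r a b /\ e = [set iota a; iota b])
          (e \in edges (image_graph r_sym r_irr)).
Proof.
apply: (iffP imsetP) => [[[u v]] | [a [b [rab ->]]]].
  by rewrite inE /= => /image_relP[a [b [-> -> rab]]] ->; exists a, b.
by exists (iota a, iota b); rewrite // inE /= image_relE.
Qed.

Lemma image_degenerate r (r_sym : symmetric r) (r_irr : irreflexive r) d :
  (forall S : {set W}, S != finset.set0 ->
     exists2 v, v \in S & #|[set u in S | r v u]| <= d) ->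
  degenerate (image_graph r_sym r_irr) d.
Proof.
move=> degr; apply/forallP => S; apply/implyP => /set0Pn[v vS].
have [S0 | /degr[w]] := eqVneq (iota @^-1: S) finset.set0.
  apply/existsP; exists v; rewrite vS /= /induced_degree.
  rewrite (_ : [set u in S | _] = finset.set0) ?cards0 //.
  apply/setP => u; rewrite !inE; apply/negP => /andP[_ /image_relP[a [b [va _ _]]]].
  have : a \in iota @^-1: S by rewrite inE -va.
  by rewrite S0 inE.
rewrite inE => wS degw; apply/existsP; exists (iota w); rewrite wS /=.
apply: leq_trans degw; rewrite -(card_imset _ iota_inj) subset_leq_card //.
apply/fintype.subsetP => u; rewrite inE => /andP[uS /image_relP[a [b [/iota_inj-> ub rab]]]].
by rewrite ub imset_f // !inE -ub uS.
Qed.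

End ImageGraph.

Lemma leq_card_image_minus (T W : finType) (g : T -> W) (N : {set W}) (v : W) :
  v \in codom g -> v \notin N -> {subset N <= codom g} -> #|N| <= #|T|.-1.
Proof.
move=> v_g vN N_g.
have : #|v |: N| <= #|[set g z | z : T]|.
  apply: subset_leq_card; apply/fintype.subsetP => u; rewrite !inE.
  have to_imset w : w \in codom g -> w \in [set g z | z : T].
    by case/codomP => z ->; rewrite imset_f.
  by case/predU1P => [-> | /N_g]; exact: to_imset.
rewrite cardsU1 vN add1n => /leq_trans/(_ (leq_imset_card g T)).
by rewrite cardE; case: #|T|.
Qed.

(** * The gadget and its degeneracy *)

Section Gadget.
Variables (m t k : nat).

(* [inl (None, i, _)] is the block A_i, [inl (Some b, j, _)] the block B_j^b, and
   [inr _] the hub. *)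
Definition gadget : finType := ((option bool * 'I_m * 'I_t) + 'I_k)%type.

Implicit Types (x : {ffun 'I_m * 'I_m -> bool}) (q : 'I_m * 'I_m).
Implicit Types (u v : gadget).

Definition alice_rel x : rel gadget := fun u v =>
  match u, v with
  | inl (None, i, _), inl (Some b, j, _)
  | inl (Some b, j, _), inl (None, i, _) => b == x (i, j)
  | _, _ => false
  end.

Definition cross_rel : rel gadget := fun u v =>
  match u, v with
  | inl (None, _, _), inl (Some _, _, _)
  | inl (Some _, _, _), inl (None, _, _) => true
  | _, _ => false
  end.

Definition core q : pred gadget := fun u =>
  match u with
  | inl (None, i, _) => i == q.1
  | inl (Some _, j, _) => j == q.2
  | inr _ => true
  end.

(** Excluding all pairs between an A-block and a B-block keeps Bob's edges disjoint from Alice's and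
    independent of [x]. *)
Definition bob_rel q : rel gadget := fun u v =>
  [&& core q u, core q v, u != v & ~~ cross_rel u v].

Definition joint_rel x q : rel gadget := fun u v =>
  alice_rel x u v || bob_rel q u v.

Lemma card_gadget : #|{: gadget}| = 3 * m * t + k.
Proof. by rewrite card_sum !card_prod card_option card_bool !card_ord. Qed.

Lemma alice_cross x u v : alice_rel x u v -> cross_rel u v.
Proof. by case: u => [[[[b|] i] c]|h]; case: v => [[[[b'|] i'] c']|h']. Qed.

Lemma cross_sym : symmetric cross_rel.
Proof. by case=> [[[[b|] i] c]|h] [[[[b'|] i'] c']|h']. Qed.

Lemma alice_sym x : symmetric (alice_rel x).
Proof. by case=> [[[[b|] i] c]|h] [[[[b'|] i'] c']|h']. Qed.

Lemma bob_sym q : symmetric (bob_rel q).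
Proof. by move=> u v; rewrite /bob_rel cross_sym eq_sym andbCA. Qed.

Lemma bob_irr q : irreflexive (bob_rel q).
Proof. by move=> u; rewrite /bob_rel eqxx !andbF. Qed.

Lemma joint_sym x q : symmetric (joint_rel x q).
Proof. by move=> u v; rewrite /joint_rel alice_sym bob_sym. Qed.

Lemma joint_irr x q : irreflexive (joint_rel x q).
Proof. by move=> u; rewrite /joint_rel bob_irr; case: u => [[[[b|] i] c]|h]. Qed.

Definition core_vertex q (z : (option bool * 'I_t) + 'I_k) : gadget :=
  match z with
  | inl (l, c) => inl (l, if l is Some _ then q.2 else q.1, c)
  | inr h => inr h
  end.

Lemma core_vertex_inj q : injective (core_vertex q).
Proof. by move=> [[l c]|h] [[l' c']|h'] //= [] => [-> _ -> // | ->]. Qed.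

Lemma core_vertex_core q z : core q (core_vertex q z).
Proof. by case: z => [[[b|] c]|h] //=. Qed.

(* Two of the three core blocks, together with the hub. *)
Definition two_layers (f : bool -> option bool) (z : (bool * 'I_t) + 'I_k) :
    (option bool * 'I_t) + 'I_k :=
  match z with inl (b, c) => inl (f b, c) | inr h => inr h end.

Lemma two_layers_inj f : injective f -> injective (two_layers f).
Proof.
by move=> f_inj [[b c]|h] [[b' c']|h'] //=; [case=> /f_inj-> -> | case=> ->].
Qed.

Lemma card_two_layers : #|{: (bool * 'I_t) + 'I_k}| = k + 2 * t.
Proof. by rewrite card_sum card_prod card_bool !card_ord addnC. Qed.

(** A vertex outside the core has only Alice's edges, at most [m * t]. If [S] lies in the core, a
    vertex of A_i sees only A_i, one B-block and the hub; if [S] misses A_i, only two B-blocks and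
    the hub remain. *)
Lemma joint_low_degree x q (S : {set gadget}) :
  0 < t -> m * t <= k + 2 * t - 1 -> S != finset.set0 ->
  exists2 v, v \in S & #|[set u in S | joint_rel x q v u]| <= k + 2 * t - 1.
Proof.
move=> t_gt0 le_mt /set0Pn[v0 v0S].
have [w /andP[wS w_out] | all_core] := pickP [pred w in S | ~~ core q w].
  exists w => //; apply: leq_trans le_mt.
  have -> : m * t = #|{: 'I_m * 'I_t}| by rewrite card_prod !card_ord.
  case: w wS w_out => [[[[b|] i] c]|h] //= wS w_out.
    apply: leq_trans (leq_imset_card
      (fun p => inl (None, p.1, p.2) : gadget) predT).
    apply: subset_leq_card; apply/fintype.subsetP => u; rewrite inE.
    rewrite /joint_rel /bob_rel /= (negbTE w_out) /= orbF.
    case: u => [[[[b'|] i'] c']|h'] /andP[_] //= _.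
    by apply/imsetP; exists (i', c').
  apply: leq_trans (leq_imset_card
    (fun p => inl (Some (x (i, p.1)), p.1, p.2) : gadget) predT).
  apply: subset_leq_card; apply/fintype.subsetP => u; rewrite inE.
  rewrite /joint_rel /bob_rel /= (negbTE w_out) /= orbF.
  case: u => [[[[b'|] i'] c']|h'] /andP[_] //= /eqP->.
  by apply/imsetP; exists (i', c').
have coreS w : w \in S -> core q w.
  by move=> wS; have := all_core w; rewrite /= wS => /negbFE.
(* [f] names two blocks that, with the hub, contain [v] and its neighbours in [S]: [k + 2 * t]
   vertices, less [v] itself. *)
have low f v : v \in S ->
    v \in codom (core_vertex q \o two_layers f) ->
    {subset [set u in S | joint_rel x q v u] <=
            codom (core_vertex q \o two_layers f)} ->
    exists2 v, v \in S & #|[set u in S | joint_rel x q v u]| <= k + 2 * t - 1.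
  move=> vS v_f N_f; exists v => //.
  rewrite subn1 -card_two_layers; apply: leq_card_image_minus v_f _ N_f.
  by rewrite inE joint_irr andbF.
have [w /andP[wS w_alice] | no_alice] :=
  pickP [pred w in S | if w is inl (None, _, _) then true else false].
  case: w wS w_alice => [[[[b|] i] c]|h] //= wS _.
  have /= /eqP iq := coreS _ wS.
  apply: (low (fun b => if b then Some (x q) else None) _ wS).
    by apply/codomP; exists (inl (false, c)); rewrite /= iq.
  move=> u; rewrite inE => /andP[/coreS]; rewrite /joint_rel /bob_rel.
  case: u => [[[[b'|] i'] c']|h'] /=.
  + move=> /eqP->; rewrite !andbF orbF => /eqP->; apply/codomP; exists (inl (true, c')).
    by rewrite /= iq -surjective_pairing.
  + by move=> /eqP-> _; apply/codomP; exists (inl (false, c')).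
  + by move=> _ _; apply/codomP; exists (inr h').
have S_f u : u \in S -> u \in codom (core_vertex q \o two_layers Some).
  move=> uS; have := coreS _ uS; have := no_alice u; rewrite /= uS /=.
  case: u uS => [[[[b'|] i'] c']|h'] uS //= _; last first.
    by move=> _; apply/codomP; exists (inr h').
  by move=> /eqP->; apply/codomP; exists (inl (b', c')).
apply: (low Some v0) => // [|u]; first exact: S_f.
by rewrite inE => /andP[/S_f].
Qed.

(** * Streams and decoding *)

Section Embedded.
Variables (n : nat) (iota : gadget -> 'I_n).
Hypothesis iota_inj : injective iota.

Definition joint_graph x q : graph n :=
  image_graph iota_inj (joint_sym x q) (joint_irr x q).

(** The lower bound comes from the clique on B_j^0, B_j^1 and the hub, all of whose edges are
    Bob's. *)
Lemma joint_degeneracy x q :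
  0 < t -> m * t <= k + 2 * t - 1 ->
  degeneracy (joint_graph x q) = k + 2 * t - 1.
Proof.
move=> t_gt0 le_mt; apply: degeneracyE.
  by apply: image_degenerate => S S0; apply: joint_low_degree.
move=> e /(@degenerate_clique _ _ _ (iota \o core_vertex q \o two_layers Some)).
rewrite card_two_layers leq_subLR add1n; apply.
  by move=> z z' /iota_inj/core_vertex_inj/two_layers_inj; apply=> ? ? [].
move=> z z' zz'; rewrite /= image_relE // /joint_rel /bob_rel !core_vertex_core /=.
apply/orP; right; apply/andP; split; last by case: z z' {zz'} => [[? ?]|?] [[? ?]|?].
by rewrite (inj_eq (@core_vertex_inj q)) (inj_eq (two_layers_inj _)) // => ? ? [].
Qed.

(** Each pair of positions yields exactly one edge whatever [x] is, so the stream has constant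
    length. *)
Definition alice_edge x (p : ('I_m * 'I_t) * ('I_m * 'I_t)) : {set 'I_n} :=
  [set iota (inl (None, p.1.1, p.1.2));
       iota (inl (Some (x (p.1.1, p.2.1)), p.2.1, p.2.2))].

Definition alice_stream x : seq {set 'I_n} := map (alice_edge x) (enum predT).

Definition bob_stream q : seq {set 'I_n} :=
  enum (edges (image_graph iota_inj (bob_sym q) (bob_irr q))).

Lemma size_alice_stream x y : size (alice_stream x) = size (alice_stream y).
Proof. by rewrite !size_map. Qed.

Lemma alice_streamP x e :
  reflect (exists u v, alice_rel x u v /\ e = [set iota u; iota v])
          (e \in alice_stream x).
Proof.
apply: (iffP mapP) => [[p _ ->] | [u [v [uv ->]]]].
  by do 2![eexists]; split; last reflexivity; rewrite /= eqxx.
case: u v uv => [[[[b|] i] c]|h] [[[[b'|] i'] c']|h'] //= /eqP->.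
  by exists ((i', c'), (i, c)); rewrite ?mem_enum // finset.setUC.
by exists ((i, c), (i', c')); rewrite ?mem_enum.
Qed.

Lemma edge_stream_joint x q :
  edge_stream (joint_graph x q) (alice_stream x ++ bob_stream q).
Proof.
apply: uniq_perm; rewrite ?enum_uniq //.
  rewrite cat_uniq enum_uniq andbT; apply/andP; split.
    rewrite map_inj_uniq ?enum_uniq // => -[[i c] [i' c']] [[j d] [j' d']].
    by case/set2_eq => -[/iota_inj + /iota_inj] => // -[-> ->] [_ -> ->].
  apply/hasPn => e; rewrite mem_enum => /image_edgesP[u [v [uv ->]]].
  apply/negP => /alice_streamP[u' [v' [/alice_cross uv' /set2_eq E]]].
  move: uv; rewrite /bob_rel.
  case: E => -[/iota_inj-> /iota_inj->]; last rewrite cross_sym;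
  by rewrite uv' !andbF.
move=> e; rewrite mem_cat !mem_enum; apply/orP/image_edgesP.
  case=> [/alice_streamP | /image_edgesP] [u [v [uv ->]]]; exists u, v;
  by rewrite /joint_rel uv ?orbT.
case=> u [v [/orP[] uv ->]]; first by left; apply/alice_streamP; exists u, v.
by right; apply/image_edgesP; exists u, v.
Qed.

(** Only B_j^1 is tested: a true bit joins it completely to A_i, and for a false bit a small palette
    forces a common color. *)
Definition decode_bit (c : {ffun 'I_n -> nat}) q : bool :=
  [forall a, forall b,
     c (iota (inl (None, q.1, a))) != c (iota (inl (Some true, q.2, b)))].

(* If the bit is [false] and A_i and B_j^true shared no color, the core would need
   [k + 3 * t] pairwise distinct colors. *)
Lemma decode_bit_correct x q N (c : {ffun 'I_n -> nat}) :
  N < k + 3 * t -> proper_coloring (joint_graph x q) N c ->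
  decode_bit c q = x q.
Proof.
move=> N_lt [c_lt c_proper].
have proper u v : joint_rel x q u v -> c (iota u) != c (iota v).
  by move=> uv; apply: c_proper; rewrite /= image_relE.
case xq: (x q); rewrite /decode_bit.
  apply/'forall_forallP => a b; apply: proper.
  by rewrite /joint_rel /= -surjective_pairing xq.
apply/negP => /'forall_forallP disj.
pose color z : 'I_N := Ordinal (c_lt (iota (core_vertex q z))).
suff /leq_card : injective color.
  rewrite card_sum card_prod card_option card_bool !card_ord; lia.
move=> z z' /(congr1 val) /= /eqP; apply: contraTeq => zz'.
have [cr|ncr] := boolP (cross_rel (core_vertex q z) (core_vertex q z')); last first.
  apply: proper; rewrite /joint_rel /bob_rel !core_vertex_core ncr /=.
  by rewrite (inj_eq (@core_vertex_inj q)) zz' orbT.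
case: z z' {zz'} cr => [[[[]|] a]|h] [[[[]|] a']|h'] //= _.
- by rewrite eq_sym.
- by apply: proper; rewrite /joint_rel /= -surjective_pairing xq.
- by apply: proper; rewrite /joint_rel /= -surjective_pairing xq.
Qed.

End Embedded.
End Gadget.

(** * Reduction from INDEX and the quadratic bound *)

Lemma process_cat (n s : nat) (A : det_algorithm n s) (time : nat)
    (mem : s.-tuple bool) (st1 st2 : seq {set 'I_n}) :
  process A time mem (st1 ++ st2) =
  process A (time + size st1) (process A time mem st1) st2.
Proof.
elim: st1 time mem => [|e st1 IH] time mem /=; first by rewrite addn0.
by rewrite IH addSnnS.
Qed.

(** The message is the memory after Alice's stream, and Bob's part is replayed from it for each
    position. Having [lambda <= t] at this degeneracy keeps the palette below [k + 3 * t]. *)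
Lemma space_of_gadget (R : realType) (n s m t k : nat)
    (A : rand_algorithm R n s) (lambda : nat -> nat) :
  0 < t -> m * t <= k + 2 * t - 1 -> 3 * m * t + k <= n ->
  lambda (k + 2 * t - 1) <= t -> colors_with A lambda ->
  m * m <= 15 * s + 10.
Proof.
set kappa := k + 2 * t - 1 => t_gt0 le_mt fits le_lambda colA.
have fits' : #|{: gadget m t k}| <= n by rewrite card_gadget.
pose iota (v : gadget m t k) : 'I_n := widen_ord fits' (enum_rank v).
have iota_inj : injective iota.
  by move=> u v /(congr1 val) /= uv; apply: enum_rank_inj; exact: val_inj.
pose X := {ffun 'I_m * 'I_m -> bool}.
pose stream (j : X * ('I_m * 'I_m)) := alice_stream iota j.1 ++ bob_stream iota_inj j.2.
pose E j := [set w | proper_coloring (joint_graph iota_inj j.1 j.2)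
  (kappa + lambda kappa) (run (alg_of A w) kappa (stream j))]%classic.
have [w good_w] : exists w, 2 * #|{: X * ('I_m * 'I_m)}| <= 3 * #|[set j | w \in E j]|.
  apply: (exists_many_events (P := coin_law A)) => j.
    exact: (@measurable_coloring_event R n s A kappa (stream j)).
  have := colA _ _ (edge_stream_joint iota_inj j.1 j.2).
  by rewrite /= joint_degeneracy.
pose B := alg_of A w.
pose f (x : X) := process B 0 (init B kappa) (alice_stream iota x).
(* Every matrix gives the same edge count, so the all-false one sets Bob's clock. *)
pose g (mem : s.-tuple bool) : X := [ffun q => decode_bit iota (output B
  (process B (size (alice_stream iota [ffun=> false])) mem (bob_stream iota_inj q))) q].
have := @index_lower_bound _ s f g.
rewrite card_prod !card_ord; apply.
have -> : 2 ^ (m * m) = #|X| by rewrite card_ffun card_bool card_prod card_ord.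
rewrite [m * m * _]mulnC; move: good_w; rewrite !card_prod !card_ord => good_w.
apply: leq_trans good_w _; rewrite leq_mul2l /=.
rewrite -sum1dep_card big_mkcond -(pair_bigA _ (fun x q => if w \in E (x, q) then 1 else 0)) /=.
apply: leq_sum => x _; rewrite -big_mkcond sum1dep_card.
apply: subset_leq_card; apply/fintype.subsetP => q; rewrite !inE => Exq.
rewrite /g ffunE eq_sym; apply/eqP.
apply: (@decode_bit_correct _ _ _ _ _ iota_inj x q (kappa + lambda kappa)).
  rewrite -[ltnLHS]/(k + 2 * t - 1 + lambda kappa); lia.
rewrite (size_alice_stream iota _ x) /f -[size _]add0n -process_cat.
exact: Exq.
Qed.

(** Without memory the output depends on the coins alone, and some coins would give one coloring
    that is injective (complete graph) and uses [lambda] colors (empty graph). Positivity of [s]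
    later absorbs the additive 10. *)
Lemma space_gt0 (R : realType) (n s lambda : nat) (A : rand_algorithm R n s) :
  lambda < n -> colors_with A (fun=> lambda) -> 0 < s.
Proof.
move=> lt_ln colA; case: s => [|//] in A colA *; exfalso.
have sym0 : symmetric (fun _ _ : 'I_n => false) by [].
have irr0 : irreflexive (fun _ _ : 'I_n => false) by [].
have symT : symmetric (fun u v : 'I_n => u != v) by move=> u v; rewrite eq_sym.
have irrT : irreflexive (fun u v : 'I_n => u != v) by move=> u; rewrite eqxx.
pose G (b : bool) := if b then Graph symT irrT else Graph sym0 irr0.
pose E b := [set w | proper_coloring (G b) (degeneracy (G b) + lambda)
  (run (alg_of A w) (degeneracy (G b)) (enum (edges (G b))))]%classic.
have [w good_w] : exists w, 2 * #|{: bool}| <= 3 * #|[set b | w \in E b]|.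
  apply: (exists_many_events (P := coin_law A)) => b.
    exact: (@measurable_coloring_event R n 0 A _ _
      (proper_coloring (G b) (degeneracy (G b) + lambda))).
  exact: colA (perm_refl _).
have both b : E b w.
  apply: contrapT => nEb.
  suff : #|[set b' | w \in E b']| <= 1 by rewrite card_bool in good_w; lia.
  apply: leq_trans (_ : #|[set ~~ b]| <= 1); last by rewrite cards1.
  apply: subset_leq_card; apply/fintype.subsetP => b'.
  rewrite finset.in_set => /set_mem Eb'; rewrite finset.in_set1.
  by case: b b' nEb Eb' => [] [].
pose col := output (alg_of A w) [tuple].
have runE kappa st : run (alg_of A w) kappa st = col.
  by rewrite /run tuple0.
have [] := both true; rewrite runE => _ col_inj.
have deg0 : degeneracy (G false) = 0.
  apply: degeneracyE => //; apply/forallP => S; apply/implyP => /set0Pn[v vS].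
  apply/existsP; exists v; rewrite vS /= leqn0 cards_eq0.
  by apply/eqP/setP => u; rewrite !inE andbF.
have [col_lt _] := both false; rewrite deg0 runE add0n in col_lt.
pose color v : 'I_lambda := Ordinal (col_lt v).
suff /leq_card : injective color by rewrite !card_ord leqNgt lt_ln.
move=> u v /(congr1 val) /= /eqP; apply: contraTeq => uv.
exact: col_inj.
Qed.

Lemma leq_double_floor (n d : nat) : 0 < d -> d <= n -> n <= 2 * d * (n %/ d).
Proof.
move=> d_gt0 le_dn; have := divn_eq n d; have := ltn_pmod n d_gt0.
have : 0 < n %/ d by rewrite divn_gt0.
set q := n %/ d; set r := n %% d; nia.
Qed.

(** With [k = m * t] the gadget has [4 * m * t] vertices, hence the choice of [m]; rounding down
    loses at most a factor 2, and 64 is 8 squared. *)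
Lemma space_quadratic (R : realType) (n s t : nat) (A : rand_algorithm R n s)
    (lambda : nat -> nat) :
  0 < t -> 4 * t <= n ->
  lambda (n %/ (4 * t) * t + 2 * t - 1) <= t -> colors_with A lambda ->
  n ^ 2 <= 64 * t ^ 2 * (15 * s + 10).
Proof.
move=> t_gt0 le_tn le_lambda colA; set m := n %/ (4 * t) in le_lambda *.
have le_mn : m * (4 * t) <= n by apply: leq_trunc_div.
have le_m : m * m <= 15 * s + 10.
  by apply: (@space_of_gadget R n s m t (m * t) A lambda) => //; lia.
have le_n : n <= 8 * t * m.
  rewrite (_ : 8 * t = 2 * (4 * t)); last by lia.
  by apply: leq_double_floor => //; lia.
apply: leq_trans (_ : (8 * t * m) ^ 2 <= _); first by rewrite leq_exp2r.
by rewrite expnMn expnMn leq_mul2l -mulnn le_m orbT.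
Qed.

(** * Growth estimates and the final bounds *)

(** Apply ln y <= y to y = x^d with d = e / (k + 1): the k-th power has exponent below [e], and
    [k + 1] also covers [k = 0]. *)
Lemma ln_exp_le_powR (R : realType) (e : R) (k : nat) : (0 < e)%R ->
  exists F : R, (0 <= F)%R /\
    forall x : R, (1 <= x)%R -> (ln x ^+ k <= F * x `^ e)%R.
Proof.
move=> e_gt0; pose d : R := (e / k.+1%:R)%R.
have d_gt0 : (0 < d)%R by rewrite divr_gt0.
exists (d^-1 ^+ k)%R; split=> [|x x_ge1]; first by rewrite exprn_ge0 // invr_ge0 ltW.
have x_gt0 : (0 < x)%R by apply: lt_le_trans x_ge1.
have ln_le : (ln x <= d^-1 * x `^ d)%R.
  rewrite mulrC ler_pdivlMr // mulrC -ln_powR ltW //.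
  by apply: ln_sublinear; apply: powR_gt0.
apply: le_trans (_ : ((d^-1 * x `^ d) ^+ k <= _)%R).
  by rewrite lerXn2r // nnegrE ?ln_ge0 // mulr_ge0 ?powR_ge0 // invr_ge0 ltW.
rewrite exprMn ler_wpM2l //; first by rewrite exprn_ge0 // invr_ge0 ltW.
rewrite -powR_mulrn ?powR_ge0 // -powRrM ler_powR // mulrAC ler_pdivrMr //.
by rewrite ler_pM2l // ler_nat.
Qed.

Lemma powR_unbounded (R : realType) (e M : R) : (0 < e)%R ->
  exists N : nat, forall n, N <= n -> (M < n%:R `^ e)%R.
Proof.
move=> e_gt0; pose x : R := ((`|M| + 1) `^ e^-1)%R.
exists (Num.truncn x).+1 => n le_n.
have le_xn : (x <= n%:R)%R.
  by apply: ltW; apply: lt_le_trans (truncnS_gt x) _; rewrite ler_nat.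
have M1_ge0 : (0 <= `|M| + 1)%R by rewrite addr_ge0.
have := ge0_ler_powR (ltW e_gt0) (powR_ge0 _ _ : x \in Num.nneg) (ler0n R n) le_xn.
rewrite /x -powRrM mulVf ?gt_eqF // powRr1 //; apply: lt_le_trans.
by have := ler_norm M; lra.
Qed.

(** For [4 * lambda <= n] take [t = lambda] and use [15 * s + 10 <= 25 * s]; beyond that n^2 /
    lambda^2 is below 16 and [s >= 1] suffices. *)
Lemma lambda_space_bound (R : realType) (lambda n s : nat)
    (A : rand_algorithm R n s) :
  1 <= lambda -> lambda < n -> colors_with A (fun=> lambda) ->
  ((64 * 25)^-1 * (n%:R ^+ 2 / lambda%:R ^+ 2) <= s%:R :> R)%R.
Proof.
move=> l_gt0 lt_ln colA; have s_gt0 := space_gt0 lt_ln colA.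
have nat_bound : n ^ 2 <= 64 * lambda ^ 2 * (25 * s).
  have [le_ln | lt_nl] := leqP (4 * lambda) n.
    apply: leq_trans (space_quadratic l_gt0 le_ln _ colA) _ => //.
    by rewrite leq_mul2l; lia.
  apply: leq_trans (_ : (4 * lambda) ^ 2 <= _); first by rewrite leq_exp2r // ltnW.
  rewrite expnMn -[leqLHS]muln1 leq_mul ?leq_mul2r ?orbT //.
  by rewrite muln_gt0.
move: nat_bound; rewrite -(ler_nat R) natrX natrM natrM natrX natrM => bound.
have l2_gt0 : (0 < lambda%:R ^+ 2 :> R)%R by rewrite exprn_gt0 // ltr0n.
rewrite mulrA ler_pdivrMr // mulrC ler_pdivrMr ?mulr_gt0 //.
by apply: le_trans bound _; rewrite le_eqVlt; apply/orP; left; apply/eqP; ring.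
Qed.

(** As [b] may be negative, it is raised to [e] before [kappa] is replaced by [n]. *)
Lemma colors_of_power (R : realType) (n kappa lambda : nat) (C b e : R) :
  0 < kappa -> kappa <= n -> (b <= e)%R -> (0 <= e)%R ->
  (lambda%:R <= C * kappa%:R `^ b)%R -> (lambda%:R <= `|C| * n%:R `^ e)%R.
Proof.
move=> kappa_gt0 le_kn le_be e_ge0 /le_trans; apply.
apply: le_trans (_ : (`|C| * kappa%:R `^ b <= _)%R).
  by rewrite ler_wpM2r ?powR_ge0 // ler_norm.
rewrite ler_wpM2l //; apply: le_trans (_ : (kappa%:R `^ e <= _)%R).
  by rewrite ler_powR // ler1n.
by rewrite ge0_ler_powR // ?nnegrE // ler_nat.
Qed.

(** The gadget's degeneracy is linear in [n], which turns bounds in [kappa] into bounds in [n]. *)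
Lemma gadget_degeneracy_bounds (n t : nat) : 0 < t -> 4 * t <= n ->
  let kappa := n %/ (4 * t) * t + 2 * t - 1 in
  [/\ 0 < kappa, kappa <= n & n <= 8 * kappa].
Proof.
move=> t_gt0 le_tn; set m := n %/ (4 * t).
have m_gt0 : 0 < m by rewrite divn_gt0 // muln_gt0.
have le_mn : m * (4 * t) <= n by apply: leq_trunc_div.
have le_nm : n <= 2 * (4 * t) * m by apply: leq_double_floor => //; lia.
have le_tmt : t <= m * t by rewrite leq_pmull.
by split; lia.
Qed.

(** With t of order n^a, a = 1/2 - g, and s = O(n^(1+g)), the quadratic bound gives n^2 =
    O(n^(2a+1+g)) = O(n^(2-g)), false for large n. *)
Lemma no_semi_streaming (R : realType) (gamma : R)
    (lambda : nat -> nat -> nat) :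
  (0 < gamma)%R ->
  (exists (C : R) (kappa0 : nat), forall n kappa, kappa0 <= kappa ->
     ((lambda n kappa)%:R <= C * kappa%:R `^ (2^-1 - gamma))%R) ->
  ~ admits_semi_streaming R lambda.
Proof.
move=> gamma_gt0 [C [kappa0 lambda_le]] [s [A [[C' [k [n0 s_le]]] colA]]].
(* The cap 1/4 keeps [a] nonnegative when [gamma] is large. *)
pose g : R := Num.min gamma (4^-1)%R.
have g_gt0 : (0 < g)%R by rewrite /g lt_min gamma_gt0 invr_gt0 ltr0n.
have g_le : (g <= 4^-1)%R by rewrite /g ge_min lexx orbT.
have g_le_gamma : (g <= gamma)%R by rewrite /g ge_min lexx.
pose a : R := (2^-1 - g)%R.
have a_ge0 : (0 <= a)%R by rewrite /a; lra.
pose D : R := (`|C| + 1)%R.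
have D_ge1 : (1 <= D)%R by rewrite lerDr.
have [F [F_ge0 lnF]] := ln_exp_le_powR k g_gt0.
pose H : R := (15 * (`|C'| * F) + 10)%R.
have H_ge0 : (0 <= H)%R by rewrite addr_ge0 // mulr_ge0 // mulr_ge0.
have a1_gt0 : (0 < 1 - a)%R by rewrite /a; lra.
have [N1 bigN1] := powR_unbounded (4 * D)%R a1_gt0.
have [N2 bigN2] := powR_unbounded (64 * D ^+ 2 * H)%R g_gt0.
(* [N1] yields [4 * t <= n], [N2] the contradiction, [n0] the space bound, and [8 * kappa0] a
   degeneracy of at least [kappa0]. *)
pose n := maxn N1 (maxn N2 (maxn n0 (maxn (8 * kappa0) 1))).
have {}bigN1 : (4 * D < n%:R `^ (1 - a))%R by apply: bigN1; rewrite leq_maxl.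
have {}bigN2 : (64 * D ^+ 2 * H < n%:R `^ g)%R.
  by apply: bigN2; rewrite !leq_max leqnn !orbT.
have {}s_le : ((s n)%:R <= C' * n%:R * ln n%:R ^+ k)%R.
  by apply: s_le; rewrite !leq_max leqnn !orbT.
have le_kappa0 : 8 * kappa0 <= n by rewrite !leq_max leqnn !orbT.
have n_gt0 : 0 < n by rewrite !leq_max leqnn !orbT.
move: n bigN1 bigN2 s_le le_kappa0 n_gt0 => n bigN1 bigN2 s_le le_kappa0 n_gt0.
have n_ge1 : (1 <= n%:R :> R)%R by rewrite ler1n.
have nR_gt0 : (0 < n%:R :> R)%R by rewrite ltr0n.
have powD x y : (n%:R `^ x * n%:R `^ y = n%:R `^ (x + y) :> R)%R.
  by rewrite powRD // pnatr_eq0 -lt0n n_gt0 implybT.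
have pow_ge1 x : (0 <= x)%R -> (1 <= n%:R `^ x :> R)%R.
  by move=> x_ge0; rewrite -[leLHS](powRr0 (n%:R : R)%R) ler_powR.
have pow1 : (n%:R `^ 1 = n%:R :> R)%R by rewrite powRr1.
pose t := (Num.truncn (`|C| * n%:R `^ a)%R).+1.
have Ca_ge0 : (0 <= `|C| * n%:R `^ a)%R by rewrite mulr_ge0 // powR_ge0.
have t_le : (t%:R <= D * n%:R `^ a)%R.
  rewrite /t -natr1 /D mulrDl mul1r lerD ?pow_ge1 //.
  by rewrite truncn_le.
have le_tn : 4 * t <= n.
  rewrite -(ler_nat R) natrM; apply: le_trans (_ : (4 * D * n%:R `^ a <= _)%R).
    by rewrite -mulrA ler_wpM2l.
  have split_n : (n%:R = n%:R `^ (1 - a) * n%:R `^ a :> R)%R by rewrite powD subrK.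
  rewrite [leRHS]split_n ler_wpM2r ?powR_ge0 //.
  exact: ltW.
have t_gt0 : 0 < t by [].
have [kappa_gt0 kappa_le kappa_ge] := gadget_degeneracy_bounds t_gt0 le_tn.
set kappa := n %/ (4 * t) * t + 2 * t - 1 in kappa_gt0 kappa_le kappa_ge.
have {}kappa_ge : kappa0 <= kappa.
  by rewrite -(@leq_pmul2l 8) //; apply: leq_trans kappa_ge.
have lambda_t : lambda n kappa <= t.
  rewrite -(ler_nat R); apply: le_trans (ltW (truncnS_gt _)).
  apply: (colors_of_power kappa_gt0 kappa_le _ a_ge0 (lambda_le _ _ kappa_ge)).
  by rewrite /a lerD2l lerN2.
have := space_quadratic t_gt0 le_tn lambda_t (colA n).
rewrite -(ler_nat R) natrX natrM natrM natrX natrD natrM => n2_le.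
have s_le' : (15 * (s n)%:R + 10 <= H * n%:R `^ (1 + g))%R.
  rewrite /H [leRHS]mulrDl lerD //; last by rewrite ler_peMr // pow_ge1 // addr_ge0 // ltW.
  rewrite -mulrA ler_wpM2l // (le_trans s_le) // -powD pow1.
  rewrite -!mulrA; apply: le_trans (_ : (`|C'| * (n%:R * ln n%:R ^+ k) <= _)%R).
    by rewrite ler_wpM2r ?ler_norm // mulr_ge0 // exprn_ge0 // ln_ge0.
  rewrite ler_wpM2l // mulrCA ler_wpM2l //; exact: lnF.
have t2_le : (64 * t%:R ^+ 2 <= 64 * D ^+ 2 * n%:R `^ (a + a))%R.
  rewrite -mulrA ler_wpM2l // -powD -expr2 -exprMn lerXn2r //.
    by rewrite nnegrE.
  by rewrite nnegrE mulr_ge0 ?powR_ge0 // (le_trans ler01).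
have : (n%:R ^+ 2 <= 64 * D ^+ 2 * n%:R `^ (a + a) * (H * n%:R `^ (1 + g)))%R.
  apply: le_trans n2_le _; apply: ler_pM t2_le s_le'.
    by rewrite mulr_ge0 // exprn_ge0.
  by rewrite addr_ge0 // mulr_ge0.
have -> : (n%:R ^+ 2 = n%:R `^ g * (n%:R `^ (a + a) * n%:R `^ (1 + g)) :> R)%R.
  by rewrite !powD -powR_mulrn //; congr (_ `^ _)%R; rewrite /a; field.
rewrite [leRHS](_ : _ = (64 * D ^+ 2 * H) *
  (n%:R `^ (a + a) * n%:R `^ (1 + g)))%R; last by ring.
by rewrite ler_pM2r ?mulr_gt0 ?powR_gt0 // leNgt bigN2.
Qed.

Theorem theorem5p7 (R : realType) :
  (exists c : R, (0 < c)%R /\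
     forall (lambda n s : nat) (A : rand_algorithm R n s),
       1 <= lambda -> lambda < n ->
       colors_with A (fun=> lambda) ->
       (c * (n%:R ^+ 2 / lambda%:R ^+ 2) <= s%:R)%R)
  /\
  (forall (gamma : R) (lambda : nat -> nat -> nat),
     (0 < gamma)%R ->
     (forall n kappa, 1 <= lambda n kappa) ->
     (exists (C : R) (kappa0 : nat), forall n kappa, kappa0 <= kappa ->
        ((lambda n kappa)%:R <= C * kappa%:R `^ (2^-1 - gamma))%R) ->
     ~ admits_semi_streaming R lambda).
Proof.
split; last by move=> gamma lambda gamma_gt0 _; exact: no_semi_streaming.
exists (64 * 25)^-1%R; split; first by rewrite invr_gt0 mulr_gt0.
by move=> lambda n s A; exact: lambda_space_bound.
Qed.
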